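(* Let $k\ge2$ and let $(v_1,\dots,v_k)$ be an inductive configuration with covariance matrix $R=R(r_1,\dots,r_{k-1})$, and assume that $$\|v_k-v_{k-1}\|_2\ \neq\ \operatorname{diam}\Big(\bigcap_{j<k-1}S_{v_j,r_j}\Big).$$ Then $R$ is sphere Ramsey for measurable colorings; that is, for every positive integer $c$ there is $n_0$ such that for all $n\ge n_0$, for every partition of $\mathbb{S}^{n-1}$ into $c$ measurable color classes, some color class contains all of $x_1,\dots,x_k$ for some $(x_1,\dots,x_k)\in\Delta(n,R)$.
   Context: $\mathbb{S}^{n-1}=\{x\in\mathbb{R}^n: x\cdot x=1\}$; measurability is with respect to the uniform surface measure on $\mathbb{S}^{n-1}$. An inductive configuration is a tuple $(v_1,\dots,v_k)$ of distinct unit vectors (on some sphere $\mathbb{S}^{m-1}$) for which there are reals $r_1,\dots,r_{k-1}$ with $\langle v_i,v_j\rangle=r_i$ for all $i<j$. Its covariance matrix $R=R(r_1,\dots,r_{k-1})$ is the Gram matrix $(v_1,\dots,v_k)^T(v_1,\dots,v_k)$, i.e. the symmetric $k\times k$ matrix with diagonal entries $1$ and $(i,j)$ entry $r_{\min(i,j)}$ for $i\neq j$. For a point $v$ of the sphere and a real $r$, $S_{v,r}=\{x : \|x\|_2=1,\ \langle x,v\rangle=r\}$ is the subsphere of the ambient sphere; for $k=2$ the empty intersection $\bigcap_{j<1}S_{v_j,r_j}$ is the whole sphere (of diameter $2$). Diameters are Euclidean; the diameter of $\bigcap_{j<k-1}S_{v_j,r_j}$ does not depend on the ambient dimension, so the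 hypothesis is a condition on $R$ only. $\Delta(n,R)=\{(x_1,\dots,x_k)\in(\mathbb{S}^{n-1})^k : (x_1,\dots,x_k)^T(x_1,\dots,x_k)=R\}$ is the set of congruent copies of the configuration in $\mathbb{S}^{n-1}$. *)

(* Defs.v *)
From HB Require Import structures.
From mathcomp Require Import all_boot all_order all_algebra.
From mathcomp Require Import all_classical all_reals all_analysis.

Set Implicit Arguments.
Unset Strict Implicit.
Unset Printing Implicit Defensive.

Import Order.TTheory GRing.Theory Num.Theory.

Local Open Scope classical_set_scope.
Local Open Scope ring_scope.

(* Points of R^n are column vectors. The norm that the library puts on
   matrices is the max-norm, hence the explicit Euclidean norm below. *)
Definition dot (K : realType) (n : nat) (x y : 'cV[K]_n) : K :=
  \sum_(a < n) x a ord0 * y a ord0.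

Definition norm2 (K : realType) (n : nat) (x : 'cV[K]_n) : K :=
  Num.sqrt (dot x x).

(* usphere K n is the sphere S^(n-1) of R^n. *)
Definition usphere (K : realType) (n : nat) : set 'cV[K]_n :=
  [set x | dot x x = 1].

Definition subsphere (K : realType) (n : nat) (v : 'cV[K]_n) (r : K) :
    set 'cV[K]_n :=
  [set x | norm2 x = 1 /\ dot x v = r].

(* Euclidean diameter; maxe makes the diameter of the empty set 0. *)
Definition diam (K : realType) (n : nat) (A : set 'cV[K]_n) : \bar K :=
  maxe 0%E (ereal_sup [set (norm2 (x - y))%:E | x in A & y in A]).

(* Hausdorff measure of dimension s, up to the usual positive normalizing
   constant. In dimension 0 a nonempty set of a cover counts for diam ^ 0 = 1
   while the empty set still counts for 0. *)
Definition hausdorff_gauge (K : realType) (n s : nat) (A : set 'cV[K]_n) :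
    \bar K :=
  (if `[< A = set0 >] then 0 else diam A ^+ s)%E.

Definition hausdorff_delta (K : realType) (n s : nat) (delta : K)
    (A : set 'cV[K]_n) : \bar K :=
  ereal_inf [set (\sum_(0 <= i <oo) hausdorff_gauge s (U i))%E |
    U in [set U : nat -> set 'cV[K]_n |
      A `<=` \bigcup_i U i /\ forall i, (diam (U i) <= delta%:E)%E]].

Definition hausdorff_measure (K : realType) (n s : nat) (A : set 'cV[K]_n) :
    \bar K :=
  ereal_sup [set hausdorff_delta s delta A | delta in [set d : K | 0 < d]].

(* The surface measure of S^(n-1), as an outer measure on R^n concentrated on
   the sphere: the (n-1)-dimensional Hausdorff measure. Normalizing it to total
   mass 1 would not change its measurable sets. *)
Definition surface_measure (K : realType) (n : nat) (A : set 'cV[K]_n) :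
    \bar K :=
  hausdorff_measure n.-1 (A `&` @usphere K n).

(* Caratheodory measurability for the outer measure, i.e. measurability for
   the completed surface measure. *)
Definition surface_measurable (K : realType) (n : nat) (A : set 'cV[K]_n) :
    Prop :=
  A `<=` @usphere K n /\ caratheodory_measurable (@surface_measure K n) A.

(* A k-tuple of points of R^m is the m x k matrix having them as columns, so
   that its Gram matrix is v^T *m v. Indices are 0-based: v_(i+1) is col i v
   and r_(i+1) is r i; only the values of r below k.-1 are relevant. *)
Definition inductive_configuration (K : realType) (m k : nat)
    (v : 'M[K]_(m, k)) (r : nat -> K) : Prop :=
  [/\ forall i, @usphere K m (col i v),
      injective (fun i => col i v)
    & forall i j : 'I_k, (i < j)%N -> dot (col i v) (col j v) = r i].

Definition covariance_mx (K : realType) (k : nat) (r : nat -> K) : 'M[K]_k :=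
  \matrix_(i < k, j < k) (if i == j then 1 else r (minn i j)).

Definition congruent_copies (K : realType) (n k : nat) (R : 'M[K]_k) :
    set 'M[K]_(n, k) :=
  [set x | (forall i, @usphere K n (col i x)) /\ x^T *m x = R].

(* Color classes are allowed to be empty. *)
Definition measurable_coloring (K : realType) (n c : nat)
    (C : 'I_c -> set 'cV[K]_n) : Prop :=
  [/\ forall t, surface_measurable (C t),
      \bigcup_t C t = @usphere K n
    & trivIset [set: 'I_c] C].

Definition sphere_ramsey_measurable (K : realType) (k : nat) (R : 'M[K]_k) :
    Prop :=
  forall c : nat, (0 < c)%N ->
  exists n0 : nat, forall n : nat, (n0 <= n)%N ->
  forall C : 'I_c -> set 'cV[K]_n, measurable_coloring C ->
  exists (t : 'I_c) (x : 'M[K]_(n, k)),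
    @congruent_copies K n k R x /\ forall i, C t (col i x).

(* Main.v *)
Require Import Defs.
From HB Require Import structures.
From mathcomp Require Import all_boot all_order all_algebra.
From mathcomp Require Import all_classical all_reals all_analysis.
From mathcomp Require Import ring lra zify.

(** The source of monochromatic configurations is Ramsey's theorem for d-subsets
    of the coordinates (Matousek and Roedl's spread vectors). Fix a unit list
    a_1, ..., a_d and colour each d-set of coordinates by the colour of the
    vector carrying a on it. On a large homogeneous set of coordinates all
    vectors of this form have the same colour, so every matrix of diagonal 1
    that is a Gram matrix of sequences differing only in the positions of their
    nonzero entries is sphere Ramsey (sphere_ramsey_spread_gram). It remains to
    write R in this way.

    These matrices form a convex cone, because concatenating sequences adds
    Gram matrices. It contains all small perturbations of the identity
    (spread_gram_perturb), and its closure contains the Gram matrix of any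
    vectors of equal length in the plane (spread_limit_planar): translating the
    long sequence cos (s phi), sin (s phi) acts on it almost as a rotation.

    An inductive covariance matrix is an average of planar Gram matrices
    (spread_limit_prefix). Indeed the projections p_i of the later vectors on
    the span of v_1, ..., v_i satisfy v_(i+1) = p_i + q and p_(i+1) = p_i + t q
    with q orthogonal to everything before, and all these norms are determined
    by r. In the plane one can follow the same recursion, with q orthogonal to
    p_i only and with a random sign; the sign makes q orthogonal to everything
    before on average, which is all that the Gram matrix sees.

    The recursion runs as long as |p_i| < 1. For the first vectors this follows
    from distinctness of the v_i (proj_sqnorm_lt1); at the last step |p_(k-1)| = 1
    means that v_(k-1) and v_k are antipodal on the intersection of the
    subspheres, which is the case excluded by the hypothesis on the diameter. As the
    inequalities are strict, the recursion still runs for R - e 1 with e small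
    (cvg_proj_sqnorm), and the perturbations of e 1 turn the approximation of
    R - e 1 into an exact expression of R (spread_limit_interior). *)

Set Implicit Arguments.
Unset Strict Implicit.
Unset Printing Implicit Defensive.

Import Order.TTheory GRing.Theory Num.Theory.
Import numFieldNormedType.Exports.

Local Open Scope classical_set_scope.
Local Open Scope ring_scope.

(** * Ramsey's theorem for finite sets *)

(** Sets of size d are handled as subsequences of size d of a fixed list. *)
Definition homogeneous (T : eqType) (C : Type) (d : nat) (chi : seq T -> C)
    (h : seq T) (t : C) : Prop :=
  forall e, subseq e h -> size e = d -> chi e = t.

(** Ramsey's theorem for d-subsets, with a separate target size n t for each
    colour t. The bound does not depend on the ground type, so that the same
    M serves the coordinate sets of all large dimensions. *)
Lemma ramsey (d c : nat) (n : 'I_c -> nat) :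
  exists M : nat, forall (T : eqType) (chi : seq T -> 'I_c) (s : seq T),
    (M <= size s)%N ->
  exists t h, [/\ subseq h s, size h = n t & homogeneous d chi h t].
Proof.
elim: d n => [|d IHd] n.
  exists (\max_t n t) => T chi s leMs; exists (chi [::]), (take (n (chi [::])) s).
  split; first exact: take_subseq.
    by rewrite size_takel // (leq_trans _ leMs) // leq_bigmax.
  by move=> e _ /size0nil ->.
(* Induction on the sum of the target sizes: the head x of the list colours the
   d-subsets of the tail by e |-> chi (x :: e), and a set homogeneous for that
   colouring, with colour t, only has to contain a (d+1)-homogeneous set that
   is one element shorter for t, since x extends it. *)
have [m] := ubnP (\sum_t n t); elim: m n => // m IHm n lt_nm.
have [/existsP[t /eqP nt0]|/existsPn npos] := boolP [exists t, n t == 0%N].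
  exists 0%N => T chi s _; exists t, [::]; split; rewrite ?sub0seq //.
  by move=> [|x e].
have {}npos t : (0 < n t)%N by rewrite lt0n; exact: npos.
pose n' t u := if u == t then (n u).-1 else n u.
have /fin_all_exists[M HM] : forall t, exists M : nat,
    forall (T : eqType) (chi : seq T -> 'I_c) (s : seq T), (M <= size s)%N ->
    exists u h, [/\ subseq h s, size h = n' t u & homogeneous d.+1 chi h u].
  move=> t; apply: IHm; rewrite ltnS in lt_nm; apply: leq_trans lt_nm.
  rewrite (bigD1 t) //= [X in (_ < X)%N](bigD1 t) //= /n' eqxx -addSn prednK //.
  by rewrite leq_add2l; apply: eq_leq; apply: eq_bigr => u /negPf ->.
have [M' HM'] := IHd (fun=> \max_t M t).
exists M'.+1 => T chi [|x s] //= leMs.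
have [t [h0 [sub_h0 size_h0 hom_h0]]] := HM' T (fun e => chi (x :: e)) s leMs.
have [|u [h [sub_h size_h hom_h]]] := HM t T chi h0.
  by rewrite size_h0 leq_bigmax.
have sub_hs := subseq_trans sub_h sub_h0.
have [eq_ut|neq_ut] := eqVneq u t; last first.
  exists u, h; split => //; first exact: subseq_trans sub_hs (subseq_cons _ _).
  by rewrite size_h /n' (negPf neq_ut).
rewrite {u}eq_ut in size_h hom_h.
exists t, (x :: h); split; first by rewrite /= eqxx.
  by rewrite /= size_h /n' eqxx prednK.
case=> // y e; rewrite [subseq _ _]/=; case: eqP => [->|_] sub_e size_e.
  by apply: hom_h0; [exact: subseq_trans sub_h | case: size_e].
exact: hom_h.
Qed.

(** * Gram matrices of spread sequences *)

Section SpreadGram.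
Variable K : realType.
Implicit Types u w : seq K.

Definition nonzero (x : K) : bool := x != 0.

Definition seqdot u w : K := \sum_(x <- zip u w) x.1 * x.2.

(** G is the Gram matrix of finitely supported sequences that have the same
    nonzero entries in the same order and differ only in the positions of these
    entries. By Ramsey's theorem one colour class contains all the vectors
    obtained by placing these entries, in order, on a large set of coordinates. *)
Definition spread_gram (k : nat) (G : 'M[K]_k) : Prop :=
  exists (N : nat) (a : seq K) (w : 'I_k -> seq K),
    [/\ forall i, size (w i) = N,
        forall i, [seq x <- w i | nonzero x] = a
      & forall i j, G i j = seqdot (w i) (w j)].

Lemma seqdotC u w : seqdot u w = seqdot w u.
Proof.
rewrite /seqdot; elim: u w => [|x u IHu] [|y w] //=; rewrite ?big_nil //.
by rewrite !big_cons /= IHu mulrC.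
Qed.

Lemma seqdot_cat u1 u2 w1 w2 : size u1 = size w1 ->
  seqdot (u1 ++ u2) (w1 ++ w2) = seqdot u1 w1 + seqdot u2 w2.
Proof. by move=> eq_sz; rewrite /seqdot zip_cat // big_cat. Qed.

Lemma seqdot_scale (c : K) u w :
  seqdot (map ( *%R c) u) (map ( *%R c) w) = c ^+ 2 * seqdot u w.
Proof.
rewrite /seqdot; elim: u w => [|x u IHu] [|y w] //=; rewrite ?big_nil ?mulr0 //.
by rewrite !big_cons /= IHu; ring.
Qed.

Lemma seqdot_mkseq (f g : nat -> K) N :
  seqdot (mkseq f N) (mkseq g N) = \sum_(0 <= s < N) f s * g s.
Proof.
rewrite /seqdot /mkseq zip_map big_map /index_iota subn0; exact: eq_bigr.
Qed.

Lemma spread_gram0 k : spread_gram (0 : 'M[K]_k).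
Proof.
exists 0%N, [::], (fun=> [::]); split => // i j.
by rewrite mxE /seqdot big_nil.
Qed.

(** Spread Gram matrices form a convex cone: concatenation of the sequences adds
    the Gram matrices and keeps the lists of nonzero entries equal. *)
Lemma spread_gramD k (G H : 'M[K]_k) :
  spread_gram G -> spread_gram H -> spread_gram (G + H).
Proof.
move=> [N [a [w [sz fl GE]]]] [N' [a' [w' [sz' fl' HE]]]].
exists (N + N')%N, (a ++ a'), (fun i => w i ++ w' i); split => [i|i|i j].
- by rewrite size_cat sz sz'.
- by rewrite filter_cat fl fl'.
- by rewrite mxE GE HE seqdot_cat // !sz.
Qed.

Lemma spread_gramZ k (c : K) (G : 'M[K]_k) :
  0 <= c -> spread_gram G -> spread_gram (c *: G).
Proof.
rewrite le_eqVlt => /predU1P[<-|c_gt0].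
  by rewrite scale0r => _; exact: spread_gram0.
move=> [N [a [w [sz fl GE]]]].
exists N, (map ( *%R (Num.sqrt c)) a), (fun i => map ( *%R (Num.sqrt c)) (w i)).
split => [i|i|i j].
- by rewrite size_map.
- rewrite filter_map -(fl i); congr (map _ _); apply: eq_filter => x /=.
  by rewrite /nonzero mulf_eq0 negb_or sqrtr_eq0 -ltNge c_gt0.
- by rewrite mxE seqdot_scale sqr_sqrtr ?ltW // GE.
Qed.

Lemma spread_gram_sum k (I : Type) (s : seq I) (P : pred I) (F : I -> 'M[K]_k) :
  (forall i, P i -> spread_gram (F i)) -> spread_gram (\sum_(i <- s | P i) F i).
Proof.
by move=> FS; elim/big_ind: _ => //; [exact: spread_gram0 | exact: spread_gramD].
Qed.

Lemma spread_gram_tr k (G : 'M[K]_k) i j : spread_gram G -> G i j = G j i.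
Proof. by case=> N [a [w [_ _ GE]]]; rewrite !GE seqdotC. Qed.

(** The vector whose coordinates at the places h_0, h_1, ... are the entries of
    w; for y outside h, index y h is size h, so the default value 0 is read. *)
Definition place (n : nat) (h : seq 'I_n) w : 'cV[K]_n :=
  \col_y nth 0 w (index y h).

Lemma place_nil n (h : seq 'I_n) : place h [::] = 0.
Proof. by apply/matrixP => y j; rewrite !mxE nth_nil. Qed.

Lemma place_cons n (x : 'I_n) h (b : K) w y j :
  place (x :: h) (b :: w) y j = if x == y then b else place h w y j.
Proof. by rewrite !mxE /=; case: eqP. Qed.

Lemma place_notin n (h : seq 'I_n) w y j :
  size h = size w -> y \notin h -> place h w y j = 0.
Proof.
by move=> eq_sz y_h; rewrite mxE nth_default // -eq_sz leqNgt index_mem.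
Qed.

(** A placed sequence depends only on its nonzero entries and on the set of
    coordinates that receive them, which is what a colouring of subsets sees. *)
Lemma place_mask n (h : seq 'I_n) w : uniq h -> size h = size w ->
  place h w = place (mask (map nonzero w) h) [seq x <- w | nonzero x].
Proof.
move=> + eq_sz; elim: h w eq_sz => [|x h IHh] [|b w] //= [] eq_sz.
case/andP=> x_h uniq_h; apply/matrixP => y j; rewrite place_cons IHh //.
have [b0|/negPn/eqP b0] /= := boolP (nonzero b); first by rewrite place_cons.
case: eqP => // <-; rewrite b0 -IHh //.
by rewrite place_notin.
Qed.

Lemma dot_place n (h : seq 'I_n) u w : uniq h -> size h = size u ->
  size h = size w -> dot (place h u) (place h w) = seqdot u w.
Proof.
elim: h u w => [|x h IHh] [|b u] [|b' w] //=.
  by rewrite !place_nil /dot /seqdot big_nil big1 // => a _; rewrite mxE mul0r.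
case/andP=> x_h uniq_h [eq_u] [eq_w].
rewrite /seqdot /= big_cons -[\sum_(_ <- _) _]/(seqdot u w) -IHh // /dot.
rewrite (bigD1 x) //= [in RHS](bigD1 x) //= !place_cons eqxx.
rewrite !place_notin // mul0r add0r; congr (_ + _).
by apply: eq_bigr => y /negPf neq; rewrite !place_cons eq_sym neq.
Qed.

End SpreadGram.

(** Colour each set e of size a coordinates by the colour of the unit vector
    carrying the list a on e. On a homogeneous set of coordinates all the
    sequences realizing R can be placed, and they become vectors of one colour
    with Gram matrix R. *)
Lemma sphere_ramsey_spread_gram (K : realType) (k : nat) (R : 'M[K]_k) :
  spread_gram R -> (forall i, R i i = 1) -> sphere_ramsey_measurable R.
Proof.
move=> [N [a [w [sz fl RE]]]] R1 c c_gt0.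
have [M HM] := ramsey (size a) (fun _ : 'I_c => N).
exists M => n leMn C [_ cover _].
(* The default colour is only met on sets e whose vector is off the sphere. *)
pose color (e : seq 'I_n) : 'I_c :=
  if pselect (exists t, C t (place e a)) is left ex then projT1 (cid ex)
  else Ordinal c_gt0.
have [|t [h [sub_h size_h hom_h]]] := HM _ color (enum 'I_n).
  by rewrite size_enum_ord.
have uniq_h : uniq h := subseq_uniq sub_h (enum_uniq _).
pose x : 'M[K]_(n, k) := \matrix_(y, i) place h (w i) y ord0.
have colx i : col i x = place h (w i).
  by apply/matrixP => y j; rewrite (ord1 j) !mxE.
have dotx i j : dot (col i x) (col j x) = R i j.
  by rewrite !colx dot_place ?RE // size_h sz.
exists t, x; split.
  split=> [i|]; first by rewrite /usphere /= dotx R1.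
  apply/matrixP => i j; rewrite -dotx mxE; apply: eq_bigr => y _.
  by rewrite !mxE.
move=> i; pose e := mask (map (@nonzero K) (w i)) h.
have xe : col i x = place e a by rewrite colx place_mask ?fl // size_h sz.
have color_e : color e = t.
  apply: hom_h.
    by apply/subseqP; exists (map (@nonzero K) (w i)); rewrite // size_map sz.
  by rewrite size_mask ?size_map ?sz // count_map -(fl i) size_filter;
    apply: eq_count.
have ex : exists t, C t (place e a).
  have : (\bigcup_t C t) (place e a) by rewrite cover /usphere /= -xe dotx R1.
  by case=> u _ Cu; exists u.
move: color_e; rewrite /color; case: pselect => // ex' <-.
rewrite xe; exact: projT2 (cid ex').
Qed.

(** * Translates as rotations *)

Section Shifts.
Variable K : realType.

Definition window (f : nat -> K) (L m s : nat) : K :=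
  if (m <= s < m + L)%N then f (s - m)%N else 0.

(** Translates of one sequence f_0, ..., f_(L-1) padded with zeros. *)
Lemma spread_gram_shift k (f : nat -> K) (L D : nat) (m : 'I_k -> nat) :
  (forall i, m i <= D)%N ->
  spread_gram (\matrix_(i < k, j < k)
    \sum_(0 <= s < D + L) window f L (m i) s * window f L (m j) s).
Proof.
move=> leD.
exists (D + L)%N, [seq x <- mkseq f L | nonzero x],
  (fun i => mkseq (window f L (m i)) (D + L)); split => [i|i|i j].
- by rewrite size_mkseq.
- have -> : mkseq (window f L (m i)) (D + L) =
      nseq (m i) 0 ++ mkseq f L ++ nseq (D - m i) 0.
    apply: (@eq_from_nth _ 0) => [|s].
      by rewrite !size_cat !size_nseq !size_mkseq; have := leD i; lia.
    rewrite size_mkseq => lt_s; rewrite nth_mkseq // /window.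
    rewrite nth_cat size_nseq nth_nseq if_same; have [//|le_s] /= := ltnP s (m i).
    rewrite nth_cat size_mkseq nth_nseq if_same ltn_subLR //.
    by have [lt_sL|//] := ltnP s (m i + L); rewrite nth_mkseq //; lia.
  by rewrite !filter_cat !filter_nseq /nonzero eqxx cats0.
- by rewrite mxE seqdot_mkseq.
Qed.

Lemma sum_interval (A B N : nat) :
  \sum_(0 <= s < N) ((A <= s < B)%N%:R : K) = (minn N B - A)%:R.
Proof.
elim: N => [|N IHN]; first by rewrite big_geq // min0n.
rewrite big_nat_recr //= IHN -natrD; congr (_%:R).
by case: leqP; case: ltnP; lia.
Qed.

(** The translates of cos (s * phi) followed by those of sin (s * phi): each
    common coordinate s of the translates by m_i and m_j contributes
    cos ((m_i - m_j) * phi), whatever s is, and there are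
    L - |m_i - m_j| of them. Hence translation acts like a rotation by phi, up
    to the boundary effect in the first factor. *)
Lemma spread_gram_rotation k (L : nat) (phi : K) (m : 'I_k -> nat) :
  spread_gram (\matrix_(i < k, j < k)
    ((L - (m i - m j) - (m j - m i))%:R * cos (((m i)%:R - (m j)%:R) * phi))).
Proof.
pose D := \max_i m i.
have leD i : (m i <= D)%N by exact: leq_bigmax.
have := spread_gramD (spread_gram_shift (fun s => cos (s%:R * phi)) L leD)
                     (spread_gram_shift (fun s => sin (s%:R * phi)) L leD).
congr spread_gram; apply/matrixP => i j; rewrite !mxE -big_split /=.
set x := cos (_ * phi).
rewrite (eq_bigr (fun s =>
    (maxn (m i) (m j) <= s < minn (m i) (m j) + L)%N%:R * x)).
  rewrite -mulr_suml sum_interval; congr (_%:R * _).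
  by have := leD i; have := leD j; lia.
move=> s _; rewrite /window.
case: (boolP (m i <= s < m i + L)%N) => [/andP[i1 i2]|Hi]; last first.
  rewrite mul0r mul0r addr0 (_ : (_ <= s < _)%N = false) ?mul0r //.
  by apply/negP; move: Hi; lia.
case: (boolP (m j <= s < m j + L)%N) => [/andP[j1 j2]|Hj]; last first.
  rewrite mulr0 mulr0 addr0 (_ : (_ <= s < _)%N = false) ?mul0r //.
  by apply/negP; move: Hj; lia.
rewrite (_ : (_ <= s < _)%N = true) ?mul1r; last by lia.
rewrite -cosB !natrB // -mulrBl /x -cosN; congr cos; ring.
Qed.

End Shifts.

(** * Perturbations and limits *)

Section Perturbation.
Variables (K : realType) (k : nat).
Implicit Types G H X : 'M[K]_k.

Lemma spread_gram1 : spread_gram (1%:M : 'M[K]_k).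
Proof.
have := @spread_gram_rotation K k 1 0 (fun i => i).
congr spread_gram; apply/matrixP => i j; rewrite !mxE mulr0 cos0 mulr1.
by rewrite -val_eqE /=; congr (_%:R); case: eqP; lia.
Qed.

(** Both signs of an off-diagonal entry are available: for x >= 0 the sequences
    i0 and j0 coincide; for x < 0 they are (1, -1, 0) and (0, 1, -1), with inner
    product -1 and square norm 2. All other sequences have disjoint supports. *)
Lemma spread_gram_pair (i0 j0 : 'I_k) (x : K) : i0 != j0 ->
  spread_gram ((2 * `|x|)%:M + x *: (delta_mx i0 j0 + delta_mx j0 i0)).
Proof.
move=> neq_ij.
have neqv : (i0 : nat) <> j0 by move/eqP: neq_ij => neq /val_inj.
have [x_ge0|x_lt0] := lerP 0 x.
  have := @spread_gram_rotation K k 1 0 (fun i => if i == j0 then i0 else i).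
  move/(spread_gramZ x_ge0)/(spread_gramD (spread_gramZ x_ge0 spread_gram1)).
  congr spread_gram; apply/matrixP => i j; rewrite !mxE mulr0 cos0 mulr1.
  rewrite (_ : (1 - _ - _)%N =
      ((i == j) + ((i == i0) && (j == j0)) + ((i == j0) && (j == i0)))%N).
    by rewrite !natrD ger0_norm // -[in RHS]mulr_natr; ring.
  by rewrite -!val_eqE /=; case: (i =P j0 :> nat); case: (j =P j0 :> nat) => /=; lia.
(* Angle pi and length 2; the values 2 * i + 3 are at distance at least 2 from
   each other and from 0 and 1. *)
pose m (i : 'I_k) :=
  if i == i0 then 0%N else if i == j0 then 1%N else (2 * i + 3)%N.
have := @spread_gram_rotation K k 2 pi m.
have Nx_ge0 : 0 <= - x by lra.
move/(spread_gramZ Nx_ge0); congr spread_gram; apply/matrixP => i j; rewrite !mxE.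
have [<-|neq] := eqVneq i j.
  rewrite subrr mul0r cos0 subnn !subn0.
  have notboth : (i == i0) && (i == j0) = false.
    by apply/negP => /andP[/eqP-> ]; rewrite (negPf neq_ij).
  by rewrite (andbC (i == j0)) notboth mulr1n ltr0_norm //=; lra.
have mneq : m i != m j.
  apply/eqP => eqm; move/eqP: neq; apply; apply: val_inj => /=; move: eqm.
  rewrite /m -!val_eqE /=; case: (i =P i0 :> nat); case: (i =P j0 :> nat);
    case: (j =P i0 :> nat); case: (j =P j0 :> nat) => /=; lia.
have m0 : m i0 = 0%N by rewrite /m eqxx.
have m1 : m j0 = 1%N by rewrite /m eqxx eq_sym (negPf neq_ij).
rewrite mulr0n add0r.
have [/andP[/eqP-> /eqP->]|not1] := boolP ((i == i0) && (j == j0)).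
  rewrite m0 m1 (negPf neq_ij) /= sub0r mulN1r cosN cospi.
  by rewrite (_ : (2 - _ - _)%N = 1%N) //; ring.
have [/andP[/eqP-> /eqP->]|not2] := boolP ((i == j0) && (j == i0)).
  rewrite m0 m1 (_ : _ * pi = pi) ?cospi; last by ring.
  by rewrite (_ : (2 - _ - _)%N = 1%N) //= add0r; ring.
rewrite (_ : (2 - _ - _)%N = 0%N) ?mul0r ?addr0 ?mulr0 //.
move: mneq not1 not2 neq; rewrite /m -!val_eqE /=.
case: (i =P i0 :> nat); case: (i =P j0 :> nat);
    case: (j =P i0 :> nat); case: (j =P j0 :> nat) => /=; lia.
Qed.

(** The identity is interior to the cone of spread Gram matrices, within the
    space of symmetric matrices of constant diagonal: correct the off-diagonal
    entries one pair at a time. *)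
Lemma spread_gram_perturb (e : K) X : X^T = X -> (forall i, X i i = 0) ->
  \sum_i \sum_j `|X i j| <= e -> spread_gram (e%:M + X).
Proof.
move=> symX X0 leXe.
pose Q i j : 'M[K]_k := (2 * `|X i j / 2|)%:M +
  (X i j / 2) *: (delta_mx i j + delta_mx j i).
have QS i j : spread_gram (Q i j).
  have [->|] := eqVneq i j; last exact: spread_gram_pair.
  rewrite /Q X0 mul0r normr0 mulr0 scale0r addr0 raddf0.
  exact: spread_gram0.
have : spread_gram ((e - \sum_i \sum_j `|X i j|) *: 1%:M + \sum_i \sum_j Q i j).
  apply: spread_gramD.
    by apply: spread_gramZ; rewrite ?subr_ge0 //; exact: spread_gram1.
  by do 2 apply: spread_gram_sum => ? _.
congr spread_gram.
have -> : \sum_i \sum_j Q i j = (\sum_i \sum_j `|X i j|)%:M + X; last first.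
  by rewrite addrA scalemx1 -raddfD /= subrK.
pose Y := 2^-1 *: X.
have symY i j : Y i j = Y j i by rewrite /Y -{1}symX !mxE.
have YE i j : X i j / 2 = Y i j by rewrite mxE mulrC.
rewrite /Q raddf_sum.
under eq_bigr => i _.
  under eq_bigr => j _ do rewrite YE scalerDr addrA.
  rewrite big_split /= big_split /=; over.
rewrite big_split /= big_split /= -addrA; congr (_ + _).
  apply: eq_bigr => i _; rewrite raddf_sum; apply: eq_bigr => j _ /=.
  by rewrite -YE normrM [`|2^-1|]ger0_norm ?invr_ge0 //; congr (_%:M); field.
rewrite [X in _ + X]exchange_big /=.
under [X in _ + X]eq_bigr => i _ do under eq_bigr => j _ do rewrite symY.
by rewrite -matrix_sum_delta /Y -scalerDl -[RHS]scale1r; congr (_ *: _); field.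
Qed.

(** Limits of spread Gram matrices with the diagonal kept exact, so that an
    error can be absorbed by perturbing off-diagonal entries only. *)
Definition spread_limit G : Prop := forall delta : K, 0 < delta ->
  exists A, [/\ spread_gram A, forall i, A i i = G i i
             & forall i j, `|A i j - G i j| <= delta].

Lemma spread_limit_half G H :
  spread_limit G -> spread_limit H -> spread_limit (2^-1 *: (G + H)).
Proof.
move=> limG limH delta delta_gt0.
have [A [SA dA nA]] := limG _ delta_gt0; have [B [SB dB nB]] := limH _ delta_gt0.
exists (2^-1 *: (A + B)); split => [|i|i j].
- by apply: spread_gramZ; [rewrite invr_ge0 | exact: spread_gramD].
- by rewrite !mxE dA dB.
- have := nA i j; have := nB i j; rewrite !mxE !ler_norml; lra.
Qed.

(** The summand e * 1 pays for the exact correction of an approximation of G. *)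
Lemma spread_limit_interior G (e : K) :
  0 < e -> G^T = G -> spread_limit G -> spread_gram (e%:M + G).
Proof.
move=> e_gt0 symG limG.
pose N : K := (k * k).+1%:R.
have N_gt0 : 0 < N by rewrite ltr0n.
have [|A [SA dA nA]] := limG (e / N); first by rewrite divr_gt0.
have -> : e%:M + G = e%:M + (G - A) + A by rewrite addrA subrK.
apply: spread_gramD => //; apply: spread_gram_perturb => [|i|].
- rewrite raddfB /= symG; congr (_ - _); apply/matrixP => i j.
  by rewrite mxE spread_gram_tr.
- by rewrite !mxE dA subrr.
apply: (@le_trans _ _ (\sum_(i < k) \sum_(j < k) (e / N))).
  by apply: ler_sum => i _; apply: ler_sum => j _; rewrite !mxE distrC.
rewrite !sumr_const !card_ord -mulrnA -mulr_natr mulrAC ler_pdivrMr //.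
by rewrite ler_pM2l // ler_nat.
Qed.

End Perturbation.

(** * Planar configurations *)

Lemma cos_lipschitz (K : realType) (x y : K) : `|cos x - cos y| <= `|x - y|.
Proof.
wlog le_yx : x y / y <= x => [IH|].
  by have [/IH//|/ltW/IH] := leP y x; rewrite distrC (distrC y).
have [z _ ->] := @MVT_segment K cos (fun z => - sin z) y x le_yx
  (fun z _ => is_derive_cos z) (continuous_subspaceT (@continuous_cos K)).
by rewrite normrM normrN ler_piMl // sin_max.
Qed.

Section Planar.
Variable K : realType.
Implicit Types p q : K * K.

Definition pdot p q : K := p.1 * q.1 + p.2 * q.2.

Lemma polar (D : K) p : 0 < D -> pdot p p = D ->
  exists2 theta : K, 0 <= theta &
    p = (Num.sqrt D * cos theta, Num.sqrt D * sin theta).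
Proof.
case: p => x y D_gt0; rewrite /pdot /= => pD.
pose c := Num.sqrt D; have c_gt0 : 0 < c by rewrite sqrtr_gt0.
have cE : c ^+ 2 = D by rewrite sqr_sqrtr // ltW.
have xcP : (x / c) ^+ 2 + (y / c) ^+ 2 = 1.
  by rewrite !expr_div_n cE -mulrDl !expr2 pD divff // gt_eqF.
have xc1 : -1 <= x / c <= 1.
  rewrite -ler_norml -ler_sqr ?nnegrE // expr1n real_normK ?num_real //.
  by have := sqr_ge0 (y / c); lra.
have cosE : cos (acos (x / c)) = x / c by rewrite acosK // in_itv.
have sinE : sin (acos (x / c)) = `|y / c|.
  by rewrite sin_acos // -sqrtr_sqr; congr Num.sqrt; lra.
have xE : x = c * (x / c) by rewrite mulrC divfK // gt_eqF.
have yE : y = c * (y / c) by rewrite mulrC divfK // gt_eqF.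
have [y_ge0|y_lt0] := lerP 0 (y / c).
  exists (acos (x / c)); first by rewrite acos_ge0.
  by rewrite -/c cosE sinE ger0_norm // -xE -yE.
exists (pi *+ 2 - acos (x / c)).
  by have := acos_lepi xc1; have := pi_ge0 K; lra.
rewrite -/c cosB sinB cos2pi sin2pi cosE sinE ltr0_norm //.
by rewrite mul0r mul1r addr0 mul0r mul1r sub0r opprK -xE -yE.
Qed.

(** Write the angles as multiples m_i of a small angle eta, up to eta, and take
    translates of a sequence so long that all shifts are negligible. *)
Lemma spread_limit_planar (k : nat) (D : K) (u : 'I_k -> K * K) : 0 < D ->
  (forall i, pdot (u i) (u i) = D) ->
  spread_limit (\matrix_(i < k, j < k) pdot (u i) (u j)).
Proof.
move=> D_gt0 uD delta delta_gt0.
have /all_sig2[theta theta_ge0 uE] i := cid2 (polar D_gt0 (uD i)).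
have dotE i j : pdot (u i) (u j) = D * cos (theta i - theta j).
  rewrite !uE /pdot /= cosB -[D in RHS]sqr_sqrtr ?ltW //; ring.
pose eta := delta / (4 * D).
have eta_gt0 : 0 < eta by rewrite divr_gt0 // mulr_gt0.
pose m i := Num.truncn (theta i / eta).
have mP i : (m i)%:R * eta <= theta i < (m i)%:R * eta + eta.
  have /Num.Theory.truncn_itv : 0 <= theta i / eta by rewrite divr_ge0 // ltW.
  rewrite -/(m i) -natr1 ler_pdivlMr // ltr_pdivrMr //.
  by rewrite mulrDl mul1r.
pose B := \max_i m i.
have leB i : (m i <= B)%N by exact: leq_bigmax.
pose L := (Num.truncn (2 * D * B%:R / delta)).+1.
have L_gt0 : 0 < L%:R :> K by rewrite ltr0n.
have LP : D * B%:R / L%:R <= delta / 2.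
  have /Num.Theory.truncn_itv/andP[_] : 0 <= 2 * D * B%:R / delta.
    by rewrite divr_ge0 ?(ltW delta_gt0) // !mulr_ge0 // ltW.
  rewrite -/L ltr_pdivrMr // ler_pdivrMr //; lra.
exists ((D / L%:R) *: (\matrix_(i < k, j < k)
    ((L - (m i - m j) - (m j - m i))%:R * cos (((m i)%:R - (m j)%:R) * eta)))).
split => [|i|i j].
- by apply: spread_gramZ; [rewrite divr_ge0 ?ltW | exact: spread_gram_rotation].
- by rewrite !mxE subrr mul0r cos0 subnn !subn0 uD mulr1 divfK // gt_eqF.
rewrite !mxE dotE; set n := (_ - _ - _)%N; set x := cos _; set y := cos _.
have nP : (L%:R - B%:R : K) <= n%:R <= (L%:R : K).
  by rewrite lerBlDr -natrD !ler_nat; have := leB i; have := leB j; rewrite /n; lia.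
have xy : `|x - y| <= eta.
  apply: (le_trans (cos_lipschitz _ _)); have := mP i; have := mP j.
  by rewrite ler_norml; lra.
have -> : D / L%:R * (n%:R * x) - D * y =
    D * (x - y) - D / L%:R * (L%:R - n%:R) * x.
  by field; rewrite gt_eqF.
apply: (le_trans (ler_normB _ _)).
have : `|D * (x - y)| <= delta / 4.
  rewrite normrM gtr0_norm //; apply: (@le_trans _ _ (D * eta)).
    by rewrite ler_pM2l.
  by rewrite /eta le_eqVlt; apply/orP; left; apply/eqP; field; rewrite gt_eqF.
have : `|D / L%:R * (L%:R - n%:R) * x| <= delta / 2.
  rewrite normrM; apply: le_trans LP.
  have Ln_ge0 : 0 <= L%:R - n%:R :> K by lra.
  have DL_ge0 : 0 <= D / L%:R :> K by apply: divr_ge0; exact: ltW.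
  rewrite ger0_norm; last exact: mulr_ge0.
  apply: (@le_trans _ _ (D / L%:R * (L%:R - n%:R))).
    by rewrite ler_piMr ?cos_max // mulr_ge0.
  by rewrite [leRHS]mulrAC; apply: ler_wpM2l => //; lra.
lra.
Qed.

End Planar.

(** * Inductive matrices as averages of planar Gram matrices *)

Section Averaging.
Variable K : realType.
Implicit Types p q : K * K.

Lemma planar_orthogonal p (b : K) : 0 <= b ->
  exists q, pdot p q = 0 /\ pdot q q = b.
Proof.
move=> b_ge0; case: p => x y; have [xy0|xy0] := eqVneq (x ^+ 2 + y ^+ 2) 0.
  have [x0 y0] : x = 0 /\ y = 0.
    move/eqP: xy0; rewrite paddr_eq0 ?sqr_ge0 // !sqrf_eq0.
    by move=> /andP[/eqP-> /eqP->].
  exists (Num.sqrt b, 0); rewrite /pdot /= x0 y0; split; first by ring.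
  by rewrite mulr0 addr0 -expr2 sqr_sqrtr.
have xy_gt0 : 0 < x ^+ 2 + y ^+ 2 by rewrite lt_neqAle eq_sym xy0 addr_ge0 ?sqr_ge0.
pose s := Num.sqrt (b / (x ^+ 2 + y ^+ 2)).
have sE : s ^+ 2 = b / (x ^+ 2 + y ^+ 2) by rewrite sqr_sqrtr // divr_ge0 // ltW.
exists (- y * s, x * s); rewrite /pdot /=; split; first by ring.
rewrite (_ : _ + _ = s ^+ 2 * (x ^+ 2 + y ^+ 2)); last by ring.
by rewrite sE divfK.
Qed.

(** If x_0, x_1, ... have square norm D and satisfy dot x_i x_j = r_i for i < j,
    then all x_j with j >= i have the same orthogonal projection on the span of
    x_0, ..., x_(i-1), and this is the square norm of that projection as long as
    x_0, ..., x_(i-1) are linearly independent. *)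
Fixpoint proj_sqnorm (D : K) (r : nat -> K) (i : nat) : K :=
  if i is j.+1 then
    let s := proj_sqnorm D r j in s + (r j - s) ^+ 2 / (D - s)
  else 0.

Definition inductive_mx (k : nat) (D : K) (r : nat -> K) : 'M[K]_k :=
  \matrix_(i < k, j < k) if i == j then D else r (minn i j).

(** Partial averages of planar Gram matrices: the first a vectors are the planar
    vectors u_0, ..., u_(a-1), the others are random with mean p and with the
    inductive inner products between themselves. *)
Definition prefix_mx (k a : nat) (D : K) (r : nat -> K) (u : nat -> K * K)
    (p : K * K) : 'M[K]_k :=
  \matrix_(i < k, j < k)
    if (i < a)%N then pdot (u i) (if (j < a)%N then u j else p)
    else if (j < a)%N then pdot p (u j)
    else inductive_mx k D r i j.

(** The vector number a is chosen as p + e q, where q is orthogonal to p and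
    e = 1 or e = -1 with equal probability; the mean of the later ones becomes
    p + e t q, where t is dictated by r_a. As q has a random sign, it is on
    average orthogonal to all earlier choices, as the component of x_a
    orthogonal to x_0, ..., x_(a-1) is in an actual realization. *)
Lemma spread_limit_prefix (k n a : nat) (D : K) (r : nat -> K)
    (u : nat -> K * K) (p : K * K) : (a + n = k)%N -> 0 < D ->
  (forall i, (i < k)%N -> proj_sqnorm D r i < D) ->
  pdot p p = proj_sqnorm D r a ->
  (forall i, (i < a)%N -> pdot (u i) (u i) = D) ->
  spread_limit (prefix_mx k a D r u p).
Proof.
move=> ank D_gt0 sD; elim: n a u p ank => [|n IHn] a u p ank pp uD.
  have lt_ka (i : 'I_k) : (i < a)%N by have := ltn_ord i; lia.
  rewrite (_ : prefix_mx _ _ _ _ _ _ = \matrix_(i < k, j < k) pdot (u i) (u j)).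
    by apply: (@spread_limit_planar _ _ D) => // i; exact: uD (lt_ka i).
  by apply/matrixP => i j; rewrite !mxE !lt_ka.
set s := proj_sqnorm D r a in pp.
have lt_sD : s < D by apply: sD; lia.
have [q [pq qq]] : exists q, pdot p q = 0 /\ pdot q q = D - s.
  by apply: planar_orthogonal; rewrite subr_ge0 ltW.
pose t := (r a - s) / (D - s).
have tE : t * (D - s) = r a - s by rewrite divfK // gt_eqF // subr_gt0.
pose z e : K * K := (p.1 + e * q.1, p.2 + e * q.2).
pose u' e i := if i == a then z e else u i.
have dotz e f : pdot (z e) (z f) = s + e * f * (D - s).
  rewrite -qq -pp; have := pq; rewrite /pdot /z /= => pq'.
  transitivity (p.1 * p.1 + p.2 * p.2 + e * f * (q.1 * q.1 + q.2 * q.2) +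
    (e + f) * (p.1 * q.1 + p.2 * q.2)); first by ring.
  by rewrite pq' mulr0 addr0.
have IH e : e ^+ 2 = 1 -> spread_limit (prefix_mx k a.+1 D r (u' e) (z (e * t))).
  move=> e1; apply: IHn => [||i].
  - by lia.
  - rewrite dotz /= -/s (_ : e * t * (e * t) = e ^+ 2 * t ^+ 2); last by ring.
    rewrite e1 mul1r expr2 -mulrA tE /t -/s; congr (_ + _); ring.
  - rewrite ltnS leq_eqVlt /u'; case: eqP => [_ _|_ /= lt_ia].
      by rewrite dotz -expr2 e1; ring.
    exact: uD.
have N1 : (-1) ^+ 2 = 1 :> K by rewrite sqrrN expr1n.
have := spread_limit_half (IH 1 (expr1n _ _)) (IH (-1) N1).
congr spread_limit; apply/matrixP => i j; rewrite !mxE !ltnS.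
have pz e x : pdot x (z e) = pdot x p + e * pdot x q by rewrite /pdot /z /=; ring.
have zp e x : pdot (z e) x = pdot p x + e * pdot q x by rewrite /pdot /z /=; ring.
have [lt_ia|lt_ai|eq_ia] := ltngtP (i : nat) a;
  have [lt_ja|lt_aj|eq_ja] := ltngtP (j : nat) a.
all: rewrite /u' -?val_eqE /= ?(ltn_eqF lt_ia) ?(gtn_eqF lt_ai) ?(ltn_eqF lt_ja)
  ?(gtn_eqF lt_aj) ?eq_ia ?eq_ja ?eqxx.
- by field.
- by rewrite !pz; field.
- by rewrite !pz; field.
- by rewrite !zp; field.
- by field.
- rewrite !dotz (gtn_eqF lt_ai) (minn_idPr (ltnW lt_ai)); lra.
- by rewrite !zp; field.
- rewrite !dotz (ltn_eqF lt_aj) (minn_idPl (ltnW lt_aj)); lra.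
- by rewrite !dotz; field.
Qed.

Lemma spread_limit_inductive (k : nat) (D : K) (r : nat -> K) : 0 < D ->
  (forall i, (i < k)%N -> proj_sqnorm D r i < D) ->
  spread_limit (inductive_mx k D r).
Proof.
move=> D_gt0 sD.
have := @spread_limit_prefix k k 0 D r (fun=> 0) 0 (add0n k) D_gt0 sD.
rewrite (_ : prefix_mx _ _ _ _ _ _ = inductive_mx k D r).
  by apply; rewrite // /pdot /= !mulr0 addr0.
by apply/matrixP => i j; rewrite !mxE.
Qed.

Lemma cvg_proj_sqnorm (r : nat -> K) (i : nat) :
  (forall j, (j < i)%N -> proj_sqnorm 1 r j < 1) ->
  proj_sqnorm D r i @[D --> 1^'-] --> proj_sqnorm 1 r i.
Proof.
elim: i => [|i IHi] lt1 /=; first exact: cvg_cst.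
have cvgs := IHi (fun j lt_ji => lt1 j (ltnW lt_ji)).
have cvg_rs : (r i - proj_sqnorm D r i) @[D --> 1^'-] --> r i - proj_sqnorm 1 r i.
  by apply: cvgB => //; exact: cvg_cst.
apply: cvgD => //; apply: cvgM; first by rewrite expr2; exact: cvgM.
apply: cvgV; first by rewrite gt_eqF // subr_gt0; exact: lt1.
by apply: cvgB => //; exact: cvg_at_left_filter.
Qed.

(** The strict inequalities leave room to write the matrix as e * 1 plus an
    inductive matrix of diagonal 1 - e to which the averaging still applies. *)
Lemma spread_gram_inductive (k : nat) (r : nat -> K) :
  (forall i, (i < k)%N -> proj_sqnorm 1 r i < 1) ->
  spread_gram (inductive_mx k 1 r).
Proof.
move=> lt1.
have near_lt (i : 'I_k) : \forall D \near (1 : K)^'-, proj_sqnorm D r i < D.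
  have cvgs : (D - proj_sqnorm D r i) @[D --> (1 : K)^'-] -->
      1 - proj_sqnorm 1 r i.
    apply: cvgB; first exact: cvg_at_left_filter.
    by apply: cvg_proj_sqnorm => j lt_ji; apply: lt1; exact: ltn_trans lt_ji _.
  have : 0 < 1 - proj_sqnorm 1 r i by rewrite subr_gt0 lt1.
  move/(cvgr_gt _ cvgs); apply: filterS => D; by rewrite subr_gt0.
have near_gt0 : \forall D \near (1 : K)^'-, 0 < D by exact: nbhs_left_gt.
have near_lt1 : \forall D \near (1 : K)^'-, D < 1 by exact: nbhs_left_lt.
have [D [[D_gt0 D_lt1] sD]] :=
  filter_ex (filterI (filterI near_gt0 near_lt1) (filter_forall _ near_lt)).
have -> : inductive_mx k 1 r = (1 - D)%:M + inductive_mx k D r.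
  apply/matrixP => i j; rewrite !mxE; case: eqP => _; last by rewrite add0r.
  by rewrite mulr1n subrK.
apply: spread_limit_interior; first by rewrite subr_gt0.
  by apply/matrixP => i j; rewrite !mxE eq_sym minnC.
by apply: spread_limit_inductive => // i lt_ik; exact: (sD (Ordinal lt_ik)).
Qed.

End Averaging.

(** * Projections and the diameter *)

Section Geometry.
Variables (K : realType) (m : nat).
Implicit Types x y z : 'cV[K]_m.

Lemma dotC x y : dot x y = dot y x.
Proof. by apply: eq_bigr => a _; rewrite mulrC. Qed.

Lemma dotDr x y z : dot x (y + z) = dot x y + dot x z.
Proof.
by rewrite /dot -big_split; apply: eq_bigr => a _; rewrite !mxE mulrDr.
Qed.

Lemma dotZr (c : K) x y : dot x (c *: y) = c * dot x y.
Proof.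
by rewrite /dot mulr_sumr; apply: eq_bigr => a _; rewrite !mxE mulrCA.
Qed.

Lemma dotBr x y z : dot x (y - z) = dot x y - dot x z.
Proof. by rewrite -scaleN1r dotDr dotZr mulN1r. Qed.

Lemma dotBl x y z : dot (y - z) x = dot y x - dot z x.
Proof. by rewrite dotC dotBr !(dotC x). Qed.

Lemma dotDl x y z : dot (y + z) x = dot y x + dot z x.
Proof. by rewrite dotC dotDr !(dotC x). Qed.

Lemma dot_ge0 x : 0 <= dot x x.
Proof. by apply: sumr_ge0 => a _; rewrite -expr2 sqr_ge0. Qed.

Lemma dot_eq0 x : dot x x = 0 -> x = 0.
Proof.
move=> /eqP; rewrite psumr_eq0 => [/allP x0|a _]; last by rewrite -expr2 sqr_ge0.
apply/matrixP => a j; rewrite (ord1 j) mxE; apply/eqP.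
by have := x0 a (mem_index_enum _); rewrite mulf_eq0 orbb.
Qed.

Variables (w : nat -> 'cV[K]_m) (r : nat -> K).

(** The orthogonal projection of w_i, w_(i+1), ... on the span of
    w_0, ..., w_(i-1), by Gram-Schmidt. *)
Fixpoint common_proj (i : nat) : 'cV[K]_m :=
  if i is j.+1 then
    let s := proj_sqnorm 1 r j in
    common_proj j + ((r j - s) / (1 - s)) *: (w j - common_proj j)
  else 0.

Lemma dot_common_proj (i : nat) x :
  (forall j, (j < i)%N -> proj_sqnorm 1 r j < 1) ->
  (forall j, (j < i)%N -> dot x (w j) = r j) ->
  dot x (common_proj i) = proj_sqnorm 1 r i.
Proof.
elim: i => [|i IHi] lt1 xw /=.
  by rewrite -(scale0r (0 : 'cV[K]_m)) dotZr mul0r.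
rewrite dotDr dotZr dotBr xw // IHi => [|j lt_ji|j lt_ji].
- by congr (_ + _); rewrite expr2; ring.
- by apply: lt1; exact: ltnW.
- by apply: xw; exact: ltnW.
Qed.

Lemma dot_common_proj_self (i : nat) :
  (forall j, (j < i)%N -> proj_sqnorm 1 r j < 1) ->
  (forall j, (j < i)%N -> dot (w j) (w j) = 1) ->
  (forall j l, (j < l < i)%N -> dot (w l) (w j) = r j) ->
  dot (common_proj i) (common_proj i) = proj_sqnorm 1 r i.
Proof.
elim: i => [|i IHi] lt1 ww1 wwr /=.
  by rewrite -(scale0r (0 : 'cV[K]_m)) dotZr mul0r.
have lt1i := lt1 i (ltnSn i).
have cc : dot (common_proj i) (common_proj i) = proj_sqnorm 1 r i.
  apply: IHi => [j ?|j ?|j l /andP[? ?]]; [apply: lt1|apply: ww1|apply: wwr];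
    rewrite ?ltnS; lia.
have wc : dot (w i) (common_proj i) = proj_sqnorm 1 r i.
  by apply: dot_common_proj => [j ?|j ?]; [apply: lt1; exact: ltnW|apply: wwr; lia].
set s := proj_sqnorm 1 r i in lt1i cc wc *.
rewrite dotDr dotZr dotBr !dotDl !(dotC (_ *: _)) !dotZr !dotBr.
rewrite !(dotC (common_proj i) (w i)) cc wc ww1 //.
by field; rewrite gt_eqF // subr_gt0.
Qed.

(** If proj_sqnorm 1 r i = 1, then the unit vectors w_i and w_(i+1) both coincide
    with their projection common_proj i. *)
Lemma proj_sqnorm_lt1 (n : nat) :
  (forall j, (j < n)%N -> dot (w j) (w j) = 1) ->
  (forall j l, (j < l < n)%N -> dot (w l) (w j) = r j) ->
  (forall j l, (j < l < n)%N -> w j <> w l) ->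
  forall i, (i.+1 < n)%N -> proj_sqnorm 1 r i < 1.
Proof.
move=> ww1 wwr wneq i; have [N] := ubnP i; elim: N i => // N IHN i lt_iN lt_in.
have lt1 j : (j < i)%N -> proj_sqnorm 1 r j < 1 by move=> lt_ji; apply: IHN; lia.
have cc : dot (common_proj i) (common_proj i) = proj_sqnorm 1 r i.
  apply: dot_common_proj_self => // [j ?|j l ?]; [apply: ww1|apply: wwr]; lia.
have dist l : (i <= l < n)%N ->
    dot (w l - common_proj i) (w l - common_proj i) = 1 - proj_sqnorm 1 r i.
  move=> lP; have wc : dot (w l) (common_proj i) = proj_sqnorm 1 r i.
    by apply: dot_common_proj => // j ?; apply: wwr; lia.
  rewrite dotBr !dotBl (dotC (common_proj i)) cc wc ww1; [ring|lia].
rewrite lt_neqAle -subr_ge0 -(dist i) ?dot_ge0 ?andbT; last by lia.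
apply/eqP => s1; have := wneq i i.+1; rewrite ltnSn lt_in => /(_ isT); apply.
have wcE l : (i <= l < n)%N -> w l = common_proj i.
  move=> lP; apply/eqP; rewrite -subr_eq0; apply/eqP/dot_eq0.
  by rewrite dist // s1 subrr.
by rewrite !wcE //; lia.
Qed.

End Geometry.

Lemma diam_attained (K : realType) (n : nat) (A : set 'cV[K]_n) x y :
  A x -> A y ->
  (forall z t, A z -> A t -> dot (z - t) (z - t) <= dot (x - y) (x - y)) ->
  diam A = (norm2 (x - y))%:E.
Proof.
move=> Ax Ay leA; rewrite /diam.
rewrite (_ : ereal_sup _ = (norm2 (x - y))%:E).
  by apply/max_idPr; rewrite lee_fin sqrtr_ge0.
apply/eqP; rewrite eq_le; apply/andP; split.
  apply: ge_ereal_sup => _ [z Az [t At <-]].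
  by rewrite lee_fin ler_sqrt ?dot_ge0 // leA.
by apply: ereal_sup_ubound; exists x => //; exists y.
Qed.

(** Points of the unit sphere with the same projection c lie on a sphere of
    centre c and square radius 1 - s; the parallelogram law bounds its chords. *)
Lemma dist_chord (K : realType) (n : nat) (c x y : 'cV[K]_n) (s : K) :
  dot x x = 1 -> dot y y = 1 -> dot c c = s -> dot x c = s -> dot y c = s ->
  dot (x - y) (x - y) <= 4 * (1 - s).
Proof.
move=> xx yy cc xc yc; have := dot_ge0 (x + y - 2 *: c).
have dotZl (b : K) u w : dot (b *: u : 'cV[K]_n) w = b * dot u w.
  by rewrite dotC dotZr dotC.
rewrite -scaleNr !(dotBr, dotBl, dotDr, dotDl, dotZr, dotZl).
rewrite (dotC y x) (dotC c x) (dotC c y) xx yy cc xc yc; lra.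
Qed.

(* p and q are the positions of v_(k-1) and v_k. *)
Theorem corollary4p8 (K : realType) (k m : nat) (hk : (2 <= k)%N)
    (v : 'M[K]_(m, k)) (r : nat -> K) (hv : inductive_configuration v r)
    (p q : 'I_k) (hp : p = (k - 2)%N :> nat) (hq : q = (k - 1)%N :> nat)
    (hdiam : (norm2 (col q v - col p v))%:E <>
      diam (@usphere K m `&`
        \bigcap_(j in [set j : 'I_k | (j < k - 2)%N]) subsphere (col j v) (r j))) :
  sphere_ramsey_measurable (covariance_mx k r).
Proof.
have [v1 vinj vr] := hv.
apply: sphere_ramsey_spread_gram; last by move=> i; rewrite mxE eqxx.
apply: spread_gram_inductive.
pose w (i : nat) : 'cV[K]_m := oapp (fun j : 'I_k => col j v) 0 (insub i).
have wE (i : 'I_k) : w i = col i v by rewrite /w valK.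
have w1 j : (j < k)%N -> dot (w j) (w j) = 1.
  by move=> lt_jk; rewrite (wE (Ordinal lt_jk)) v1.
have wr j l : (j < l < k)%N -> dot (w l) (w j) = r j.
  move=> /andP[lt_jl lt_lk]; have lt_jk := ltn_trans lt_jl lt_lk.
  by rewrite (wE (Ordinal lt_lk)) (wE (Ordinal lt_jk)) dotC vr.
have wneq j l : (j < l < k)%N -> w j <> w l.
  move=> /andP[lt_jl lt_lk]; have lt_jk := ltn_trans lt_jl lt_lk.
  rewrite (wE (Ordinal lt_lk)) (wE (Ordinal lt_jk)) => /vinj [] eq_jl.
  by rewrite eq_jl ltnn in lt_jl.
have lt1 := proj_sqnorm_lt1 w1 wr wneq.
move=> i lt_ik; have [/lt1//|le_ki] := ltnP i.+1 k.
(* The last index is the one that the diameter decides: the inner product t of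
   the last two vectors satisfies 2 s - 1 <= t < 1, with equality on the left
   exactly when they are antipodal on the intersection of the subspheres. *)
have -> : i = (k - 2).+1 by lia.
have lt1_k2 j : (j < k - 2)%N -> proj_sqnorm 1 r j < 1 by move=> ?; apply: lt1; lia.
have s_lt1 : proj_sqnorm 1 r (k - 2) < 1 by apply: lt1; lia.
pose c := common_proj w r (k - 2).
have cc : dot c c = proj_sqnorm 1 r (k - 2).
  apply: dot_common_proj_self => // [j ?|j l ?]; [apply: w1|apply: wr]; lia.
have xc x : (forall j, (j < k - 2)%N -> dot x (w j) = r j) ->
    dot x c = proj_sqnorm 1 r (k - 2).
  by move=> xw; apply: dot_common_proj.
have pw j : (j < k - 2)%N -> dot (w p) (w j) = r j by move=> ?; apply: wr; lia.
have qw j : (j < k - 2)%N -> dot (w q) (w j) = r j by move=> ?; apply: wr; lia.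
have pp : dot (w p) (w p) = 1 by apply: w1.
have qq : dot (w q) (w q) = 1 by apply: w1.
have qp : dot (w q) (w p) = r (k - 2)%N by rewrite -hp; apply: wr; lia.
rewrite /=; set s := proj_sqnorm 1 r (k - 2) in s_lt1 cc xc *.
set t := r (k - 2)%N in qp *.
have qpE : dot (w q - w p) (w q - w p) = 2 - 2 * t.
  by rewrite dotBr !dotBl (dotC (w p) (w q)) qp pp qq; ring.
have t_lt1 : t < 1.
  have : 0 < dot (w q - w p) (w q - w p).
    rewrite lt_neqAle dot_ge0 andbT eq_sym; apply/eqP => /dot_eq0/eqP.
    by rewrite subr_eq0 => /eqP/esym; apply: wneq; lia.
  by rewrite qpE; lra.
have t_ge : 2 * s - 1 <= t.
  have := dist_chord qq pp cc (xc _ qw) (xc _ pw); rewrite qpE; lra.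
have t_neq : t != 2 * s - 1.
  apply/eqP => tE; apply: hdiam; apply/esym.
  have inA x : dot x x = 1 -> (forall j, (j < k - 2)%N -> dot x (w j) = r j) ->
      (@usphere K m `&` \bigcap_(j in [set j : 'I_k | (j < k - 2)%N])
        subsphere (col j v) (r j)) x.
    move=> x1 xw; split=> // j lt_j; split; first by rewrite /norm2 x1 sqrtr1.
    by rewrite -wE xw.
  apply: diam_attained; first by rewrite -wE; exact: inA.
    by rewrite -wE; exact: inA.
  have outA x : (@usphere K m `&` \bigcap_(j in [set j : 'I_k | (j < k - 2)%N])
        subsphere (col j v) (r j)) x -> dot x x = 1 /\ dot x c = s.
    move=> [x1 xA]; split=> //; apply: xc => j lt_j.
    have lt_jk : (j < k)%N by lia.
    by have [_] := xA (Ordinal lt_jk) lt_j; rewrite -wE.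
  move=> x y /outA[xx xcE] /outA[yy ycE]; rewrite -!wE qpE tE.
  by have := dist_chord xx yy cc xcE ycE; lra.
have s1_gt0 : 0 < 1 - s by rewrite subr_gt0.
rewrite -ltrBrDl ltr_pdivrMr // -expr2 -subr_gt0.
rewrite (_ : _ - _ = (1 - t) * (t - (2 * s - 1))); last by ring.
by rewrite mulr_gt0 ?subr_gt0 // lt_neqAle eq_sym t_neq.
Qed.
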